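(* Let $\Bbbk$ be a field of characteristic zero and let $L=\Bbbk x\oplus\Bbbk e$ be the two-dimensional vector space with basis $x,e$, with zero initial Lie bracket $\{\,,\,\}=0$ and bilinear product $\triangleright$ determined by $$x\triangleright x=x,\qquad x\triangleright e=\tfrac12 e,\qquad e\triangleright x=e\triangleright e=0.$$ Then $(L,\{\,,\,\},\triangleright)$ is a postLie algebra which does not have property $A_{\mathrm{postAs}}$; that is, there is no injective homomorphism of postLie algebras from $L$ into the induced postLie algebra of a finite-dimensional postassociative algebra over $\Bbbk$.
   Context: All algebras are over the field $\Bbbk$. A postLie algebra is a vector space $L$ with a Lie bracket $\{\,,\,\}$ (the initial bracket) and a bilinear product $\triangleright$ such that, writing $D_x(y)=x\triangleright y$, every $D_x$ is a derivation of the Lie algebra $(L,\{\,,\,\})$, i.e. $D_x\{y,z\}=\{D_xy,z\}+\{y,D_xz\}$, and $D_xD_y-D_yD_x=D_{[x,y]}$ where $[x,y]=\{x,y\}+x\triangleright y-y\triangleright x$. Homomorphisms of postLie algebras are linear maps preserving both $\{\,,\,\}$ and $\triangleright$. A postassociative algebra is a vector space with three bilinear operations $\prec,\succ,\cdot$ such that $\cdot$ is associative and, for all $a,b,c$, $(a\prec b)\prec c=a\prec(b*c)$, $(a\succ b)\prec c=a\succ(b\prec c)$, $(a*b)\succ c=a\succ(b\succ c)$, $(a\succ b)\cdot c=a\succ(b\cdot c)$, $(a\prec b)\cdot c=a\cdot(b\succ c)$, $(a\cdot b)\prec c=a\cdot(b\prec c)$, where $a*b=a\succ b+a\prec b+a\cdot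 b$. Its induced postLie algebra is the same vector space with $\{a,b\}=a\cdot b-b\cdot a$ and $a\triangleright b=a\succ b-b\prec a$. A finite-dimensional postLie algebra $L$ has property $A_{\mathrm{postAs}}$ if it embeds (via an injective homomorphism of postLie algebras) into the induced postLie algebra of a finite-dimensional postassociative algebra. *)

(* Defs.v *)
From mathcomp Require Import all_boot all_order all_algebra.

Set Implicit Arguments.
Unset Strict Implicit.
Unset Printing Implicit Defensive.

Import GRing.Theory.
Local Open Scope ring_scope.

Section Definitions.
Variable K : fieldType.

Definition bilinear_op (V : lmodType K) (op : V -> V -> V) : Prop :=
  bilinear_for *:%R *:%R op.

Record is_Lie_bracket (L : lmodType K) (br : L -> L -> L) : Prop := {
  Lie_bilinear : bilinear_op br;
  Lie_alternating : forall x, br x x = 0;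
  Lie_Jacobi : forall x y z, br x (br y z) + br y (br z x) + br z (br x y) = 0
}.

Definition postLie_commutator (L : lmodType K) (br tr : L -> L -> L) (x y : L)
  : L := br x y + tr x y - tr y x.

Record is_postLie (L : lmodType K) (br tr : L -> L -> L) : Prop := {
  postLie_bracket : is_Lie_bracket br;
  postLie_bilinear : bilinear_op tr;
  postLie_derivation :
    forall x y z, tr x (br y z) = br (tr x y) z + br y (tr x z);
  postLie_action :
    forall x y z,
      tr x (tr y z) - tr y (tr x z) = tr (postLie_commutator br tr x y) z
}.

Record is_postLie_hom (L M : lmodType K) (brL trL : L -> L -> L)
    (brM trM : M -> M -> M) (f : {linear L -> M}) : Prop := {
  postLie_hom_bracket : {morph f : x y / brL x y >-> brM x y};
  postLie_hom_product : {morph f : x y / trL x y >-> trM x y}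
}.

Definition postAs_total (A : lmodType K) (prec succ dot : A -> A -> A)
  (a b : A) : A := succ a b + prec a b + dot a b.

Record is_postAs (A : lmodType K) (prec succ dot : A -> A -> A) : Prop := {
  postAs_prec_bilinear : bilinear_op prec;
  postAs_succ_bilinear : bilinear_op succ;
  postAs_dot_bilinear : bilinear_op dot;
  postAs_dotA : forall a b c, dot (dot a b) c = dot a (dot b c);
  postAs_prec_prec : forall a b c,
    prec (prec a b) c = prec a (postAs_total prec succ dot b c);
  postAs_succ_prec : forall a b c, prec (succ a b) c = succ a (prec b c);
  postAs_succ_succ : forall a b c,
    succ (postAs_total prec succ dot a b) c = succ a (succ b c);
  postAs_succ_dot : forall a b c, dot (succ a b) c = succ a (dot b c);
  postAs_prec_dot : forall a b c, dot (prec a b) c = dot a (succ b c);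
  postAs_dot_prec : forall a b c, prec (dot a b) c = dot a (prec b c)
}.

Definition induced_bracket (A : lmodType K) (dot : A -> A -> A) (a b : A) : A :=
  dot a b - dot b a.

Definition induced_product (A : lmodType K) (prec succ : A -> A -> A)
  (a b : A) : A := succ a b - prec b a.

Definition has_A_postAs (L : vectType K) (br tr : L -> L -> L) : Prop :=
  exists (A : vectType K) (prec succ dot : A -> A -> A),
    is_postAs prec succ dot /\
    exists f : {linear L -> A},
      injective f /\
      is_postLie_hom br tr (induced_bracket dot) (induced_product prec succ) f.

End Definitions.

(* Main.v *)
From HB Require Import structures.
Require Import Defs.
From mathcomp Require Import all_boot all_order all_algebra zify.

Set Implicit Arguments.
Unset Strict Implicit.
Unset Printing Implicit Defensive.

Import GRing.Theory.
Local Open Scope ring_scope.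

(** The postLie identities are a computation: tr e vanishes identically, so
    tr y is a multiple of tr x for every y, all these operators commute, and
    every postLie commutator is a multiple of e.

    For the second half, suppose that x and e are sent to X and E in a
    finite-dimensional postassociative algebra A. The product
    a * b = a > b + a < b + a . b is associative, and the operations >, < make
    (A, .) a bimodule over (A, * ) compatibly with its product. Hence k + A + A
    is a unital associative algebra, with linear maps rho and iota onto the two
    copies of A, such that both rho and sigma = rho + iota are multiplicative
    on (A, * ); its right regular representation realises it by matrices
    ([bimodule_extension]).
    Put h = rho X, n = iota X and q = rho E. The relations of L become
       [h, n] = n   and   [h, q] = q / 2.

    So n shifts the generalised eigenvalues of h by 1 and q shifts them
    by 1/2. Let f(h) be the spectral projection of h onto the
    eigenvalues that are not integers, where f is a polynomial with f(0) = 0.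
    Since n preserves each class of eigenvalues modulo the integers, f(h)
    commutes with n ([horner_alg_int_part_comm]). As h + n is the conjugate of
    h by exp(n), this forces f(h + n) = f(h) ([horner_alg_comm_translate]).
    But f(0) = 0 means that f(h) = rho a and f(h + n) = sigma a for the element
    a = f(X) of A, so iota a = 0, a = 0 and f(h) = 0. All eigenvalues of h are
    therefore integers; as q shifts them by 1/2, q = 0 and E = 0
    ([half_weight_eq0], [no_half_weight_pair]). *)

(** * Polynomials evaluated at an element of an algebra *)

Lemma horner_alg_shift (K : fieldType) (B : algType K) (h y : B) (c : K)
    (p : {poly K}) :
  h * y - y * h = c *: y ->
  horner_alg h p * y = y * horner_alg h (p \Po ('X + c%:P)).
Proof.
move=> hy; have {}hy : h * y = y * (h + c%:A).
  by rewrite mulrDr -scalerAr mulr1 -hy addrC subrK.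
elim/poly_ind: p => [|p d IH]; first by rewrite comp_poly0 !rmorph0 mul0r mulr0.
rewrite comp_poly_MXaddC !rmorphD !rmorphM rmorphD /= !horner_algX !horner_algC.
by rewrite mulrDl mulrDr -mulrA hy !mulrA IH -scalerAr -scalerAl mulr1 mul1r.
Qed.

Lemma coprimep_annihilators (K : fieldType) (B : algType K) (h y : B)
    (p q : {poly K}) :
  coprimep p q -> y * horner_alg h p = 0 -> y * horner_alg h q = 0 -> y = 0.
Proof.
case/Bezout_eq1_coprimepP=> -[u v] /= uv yp yq.
rewrite -[y]mulr1 -(rmorph1 (horner_alg h)) -uv [u * p]mulrC [v * q]mulrC.
by rewrite rmorphD !rmorphM mulrDr !mulrA yp yq !mul0r addr0.
Qed.

(** A polynomial substitute for the conjugation of h into h + n by exp(n):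
    P is p evaluated at h + n t. Both d/dt and - [n, .] act on the values at
    h + n t as derivations, and they agree for p = t since [h + n t, n] = n. *)
Lemma horner_alg_deformation (K : fieldType) (B : algType K) (h n : B)
    (p : {poly K}) :
  h * n - n * h = n ->
  exists P : {poly B}, [/\ P.[0] = horner_alg h p, P.[1] = horner_alg (h + n) p
    & P^`() = P * n%:P - n%:P * P].
Proof.
move=> hn; elim/poly_ind: p => [|p c [P [P0 P1 dP]]].
  by exists 0; rewrite !rmorph0 !horner0 deriv0 mul0r mulr0 subr0.
exists (P * (h%:P + n%:P * 'X) + c%:A%:P).
have lin x : (h%:P + n%:P * 'X : {poly B}).[x] = h + n * x.
  by rewrite hornerD hornerC hornerMX hornerC.
rewrite !rmorphD !rmorphM /= !horner_algX !horner_algC -P0 -P1; split.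
- rewrite hornerD hornerC hornerM_comm ?lin ?mulr0 ?addr0 //.
  by rewrite /comm_poly mulr0 mul0r.
- rewrite hornerD hornerC hornerM_comm ?lin ?mulr1 //.
  by rewrite /comm_poly mulr1 mul1r.
have cn : (c%:A%:P : {poly B}) * n%:P = n%:P * c%:A%:P.
  by rewrite -!polyCM -scalerAl -scalerAr mul1r mulr1.
have dH : (h%:P + n%:P * 'X : {poly B})^`() = n%:P.
  by rewrite derivD derivM !derivC derivX mul0r !add0r mulr1.
have hnE : h * n = n * h + n by rewrite -[X in _ + X]hn addrC subrK.
have Hn : (h%:P + n%:P * 'X) * n%:P = n%:P * (h%:P + n%:P * 'X) + n%:P.
  rewrite mulrDl mulrDr -[_ * 'X * _]mulrA -[X in n%:P * X]commr_polyX addrAC.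
  by rewrite -!polyCM -polyCD -hnE.
move: (h%:P + _) dH Hn => H dH Hn.
rewrite derivD derivM derivC addr0 dP dH mulrBl mulrDl mulrDr cn -!mulrA Hn.
by rewrite mulrDr opprD addrACA subrr addr0 addrAC.
Qed.

(** In P' = [P, n] the coefficient of degree j determines the one of degree
    j + 1 in characteristic zero; the constant one commutes with n, so all
    later ones vanish and P(1) = P(0). *)
Lemma horner_alg_comm_translate (K : fieldType) (charK0 : [pchar K] =i pred0)
    (B : algType K) (h n : B) (p : {poly K}) :
  h * n - n * h = n -> GRing.comm n (horner_alg h p) ->
  horner_alg (h + n) p = horner_alg h p.
Proof.
move=> hn np; have [P [P0 <- dP]] := horner_alg_deformation p hn.
suff PC : P = (P`_0)%:P by rewrite PC hornerC -P0 horner_coef0.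
apply/polyP=> -[|j]; rewrite coefC //=.
have cP i : P`_i.+1 *+ i.+1 = P`_i * n - n * P`_i.
  by rewrite -coef_deriv dP coefB coefMC coefCM.
have tf i (y : B) : y *+ i.+1 = 0 -> y = 0.
  move/eqP; rewrite -scaler_nat scaler_eq0 (pcharf0P _).1 //=.
  by move/eqP.
elim: j => [|j IH].
  by apply: (tf 0%N); rewrite cP -horner_coef0 P0 np subrr.
by apply: (tf j.+1); rewrite cP IH mul0r mulr0 subrr.
Qed.

(** * Integer roots *)

Lemma intr_eq0_char0 (K : fieldType) (charK0 : [pchar K] =i pred0) (z : int) :
  (z%:~R == 0 :> K) = (z == 0).
Proof.
by case: z => n; rewrite ?NegzE ?mulrNz ?oppr_eq0 -pmulrn (pcharf0P _).1.
Qed.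

Definition int_poly (K : fieldType) (s : seq int) : {poly K} :=
  \prod_(k <- s) ('X - (k%:~R)%:P).

Definition no_int_root (K : fieldType) (m : {poly K}) :=
  forall k : int, ~~ root m k%:~R.

Lemma no_int_root_shift (K : fieldType) (m : {poly K}) (c : int) :
  no_int_root m -> no_int_root (m \Po ('X + (c%:~R)%:P)).
Proof.
by move=> mP k; rewrite root_comp hornerD hornerX hornerC -intrD mP.
Qed.

Lemma int_poly_shift (K : fieldType) (s : seq int) (c : int) :
  int_poly K s \Po ('X + (c%:~R)%:P) = int_poly K [seq k - c | k <- s].
Proof.
rewrite /int_poly rmorph_prod big_map /=; apply: eq_bigr => k _.
by rewrite rmorphB /= comp_polyX comp_polyC rmorphB /= polyCB opprB addrA addrAC.
Qed.

Lemma coprimep_int_poly (K : fieldType) (m : {poly K}) (s : seq int) :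
  no_int_root m -> coprimep m (int_poly K s).
Proof.
move=> mP; rewrite /int_poly; elim: s => [|k s IH].
  by rewrite big_nil coprimep1.
by rewrite big_cons coprimepMr coprimep_XsubC mP.
Qed.

(** Stated under [classically] because the existence of an integer root is not
    decidable over an abstract field; the lemma is applied to prove a decidable
    equality. *)
Lemma int_root_factorization (K : fieldType) (p : {poly K}) :
  p != 0 ->
  classically (exists m s, p = m * int_poly K s /\ no_int_root m).
Proof.
have [d] := ubnP (size p); elim: d p => // d IH p /ltnSE lepd p0.
apply: (@classic_bind (decidable (exists k : int, root p k%:~R))).
  2: exact: classic_EM.
case=> [[k /factor_theorem [q pE]]|nor]; last first.
  apply/classicP=> H; apply: H; exists p, [::]; split.
    by rewrite /int_poly big_nil mulr1.
  by move=> k; apply/negP=> rk; apply: nor; exists k.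
have q0 : q != 0 by apply: contraNneq p0 => q0; rewrite pE q0 mul0r.
have: (size q < d)%N.
  by move: lepd; rewrite pE size_mul ?polyXsubC_eq0 // size_XsubC addnC.
move=> /IH/(_ q0); apply: classic_bind => -[m [s [qE mP]]].
apply/classicP=> H; apply: H; exists m, (k :: s); split=> //.
by rewrite pE qE /int_poly big_cons -mulrA [_ * ('X - _)]mulrC.
Qed.

(** Here v * int_poly K s evaluates at h to the spectral projection onto the
    non-integral eigenvalues. The two corner terms of n for this projection
    vanish: each is annihilated by two coprime polynomials in h, since n
    carries roots to roots shifted by 1, and such a shift preserves
    integrality. *)
Lemma horner_alg_int_part_comm (K : fieldType) (B : algType K) (h n : B)
    (u m v : {poly K}) (s : seq int) :
  h * n - n * h = n -> no_int_root m ->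
  horner_alg h (m * int_poly K s) = 0 -> u * m + v * int_poly K s = 1 ->
  GRing.comm n (horner_alg h (v * int_poly K s)).
Proof.
(* sh is the effect on polynomials in h of moving them across n. *)
set w := int_poly K s => hn mP mw uvE.
pose ev := horner_alg h; pose sh (p : {poly K}) := p \Po ('X + (1%:~R)%:P).
have evn p : ev p * n = n * ev (sh p).
  by apply: horner_alg_shift; rewrite hn scale1r.
have n_mw : n * ev (sh m) * ev (sh w) = 0.
  by rewrite -mulrA -rmorphM -comp_polyM -evn /ev mw mul0r.
have sh_m : no_int_root (sh m) by apply: no_int_root_shift.
have evM p q : ev (p * q) = ev p * ev q by rewrite /ev rmorphM.
have comm_ev p q : ev p * ev q = ev q * ev p by rewrite -!evM mulrC.
have mw0 : ev m * ev w = 0 by rewrite -rmorphM.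
have n1 : n * ev (sh m) * ev w = 0.
  apply: (@coprimep_annihilators _ _ h _ m (sh w)).
  - by rewrite /sh int_poly_shift coprimep_int_poly.
  - by rewrite -mulrA (comm_ev w m) mw0 mulr0.
  - by rewrite -mulrA (comm_ev w) mulrA n_mw mul0r.
have n2 : n * ev (sh w) * ev m = 0.
  apply: (@coprimep_annihilators _ _ h _ (sh m) w).
  - exact: coprimep_int_poly.
  - by rewrite -mulrA (comm_ev m) mulrA -[n * _ * _]mulrA (comm_ev (sh w)) mulrA
               n_mw mul0r.
  - by rewrite -mulrA mw0 mulr0.
have m_n_w : ev (u * m) * n * ev (v * w) = 0.
  by rewrite [v * w]mulrC !evM !mulrA -[ev u * _ * n]mulrA evn -!mulrA
             [n * (_ * (_ * _))]mulrA [n * _ * _]mulrA n1 mul0r mulr0.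
have w_n_m : ev (v * w) * n * ev (u * m) = 0.
  by rewrite [u * m]mulrC !evM !mulrA -[ev v * _ * n]mulrA evn -!mulrA
             [n * (_ * (_ * _))]mulrA [n * _ * _]mulrA n2 mul0r mulr0.
have one : ev (u * m) = 1 - ev (v * w).
  by apply/eqP; rewrite -subr_eq opprK -rmorphD uvE rmorph1.
move: m_n_w w_n_m; rewrite one !mulrBl !mulrBr mul1r mulr1.
move=> /subr0_eq nw /subr0_eq wn; exact: etrans nw (esym wn).
Qed.

(** * Elements of weight one half *)

(** The last hypothesis abstracts what is known of h = rho X: a polynomial
    without constant term which takes equal values at rho X and at sigma X
    vanishes there. The constant term is excluded because only such polynomials
    can be evaluated at X in a non-unital algebra. *)
Lemma half_weight_eq0 (K : fieldType) (charK0 : [pchar K] =i pred0)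
    (B : algType K) (h n q : B) (chi : {poly K}) :
  chi != 0 -> horner_alg h chi = 0 ->
  h * n - n * h = n -> h * q - q * h = 2%:R^-1 *: q ->
  (forall p, horner_alg (h + n) (p * 'X) = horner_alg h (p * 'X) ->
     horner_alg h (p * 'X) = 0) ->
  q = 0.
Proof.
move=> chi0 chih hn hq sep; apply/eqP.
apply: (int_root_factorization chi0) => -[m [s [chiE mP]]]; apply/eqP.
(* The root 0 is added so that the projection has no constant term. *)
have wE : int_poly K (0 :: s) = int_poly K s * 'X.
  by rewrite /int_poly big_cons subr0 mulrC.
have /Bezout_eq1_coprimepP [[u v] /= uvE] := coprimep_int_poly (0 :: s) mP.
have mw : horner_alg h (m * int_poly K (0 :: s)) = 0.
  by rewrite wE mulrA -chiE rmorphM /= chih mul0r.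
have f0 : horner_alg h (v * int_poly K (0 :: s)) = 0.
  have := horner_alg_int_part_comm hn mP mw uvE; rewrite wE mulrA => fn.
  exact/sep/horner_alg_comm_translate.
have w0 : horner_alg h (int_poly K (0 :: s)) = 0.
  rewrite -[int_poly K _]mul1r -uvE mulrDl -mulrA rmorphD.
  by rewrite [X in X + _]rmorphM [X in _ + X]rmorphM /= mw f0 mulr0 mul0r addr0.
(* The spectrum of h is integral; moved across q it becomes half-integral. *)
apply: (@coprimep_annihilators _ _ h _
  (int_poly K (0 :: s) \Po ('X + (2%:R^-1)%:P)) (int_poly K (0 :: s))).
- apply: coprimep_int_poly => k; rewrite root_comp hornerD hornerX hornerC.
  rewrite /int_poly -(big_map (fun k : int => k%:~R) predT (fun a => 'X - a%:P)).
  rewrite root_prod_XsubC; apply/mapP => -[j _ /eqP].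
  have two0 : 2%:R != 0 :> K by rewrite (pcharf0P _).1.
  rewrite -(inj_eq (mulfI two0)) mulrDr mulfV //.
  rewrite -subr_eq0 -[2%:R]/(2%:~R) -!intrM -[1]/(1%:~R) -intrD -intrB.
  by rewrite intr_eq0_char0 // => /eqP; lia.
- by rewrite -(horner_alg_shift _ hq) w0 mul0r.
- by rewrite w0 mulr0.
Qed.

(** * The bimodule extension of a postassociative algebra *)

Lemma bilinear_opE (K : fieldType) (A : vectType K) (op : A -> A -> A) :
  bilinear_op op ->
  [/\ forall x y z, op (x + y) z = op x z + op y z,
      forall x y z, op z (x + y) = op z x + op z y,
      forall k x z, op (k *: x) z = k *: op x z &
      forall k x z, op z (k *: x) = k *: op z x].
Proof.
case=> l r.
have lin k x y z : op (k *: x + y) z = k *: op x z + op y z by apply: l.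
have rin k x y z : op z (k *: x + y) = k *: op z x + op z y by apply: r.
have lD x y z : op (x + y) z = op x z + op y z.
  by have := lin 1 x y z; rewrite !scale1r.
have rD x y z : op z (x + y) = op z x + op z y.
  by have := rin 1 x y z; rewrite !scale1r.
have l0 z : op 0 z = 0 by apply: (addrI (op 0 z)); rewrite -lD !addr0.
have r0 z : op z 0 = 0 by apply: (addrI (op z 0)); rewrite -rD !addr0.
split=> // k x z.
  by have := lin k x 0 z; rewrite l0 !addr0.
by have := rin k x 0 z; rewrite r0 !addr0.
Qed.

Lemma bilinear_op0l (K : fieldType) (A : vectType K) (op : A -> A -> A) a :
  bilinear_op op -> op 0 a = 0.
Proof.
by case/bilinear_opE=> _ _ lZ _; have := lZ 0 0 a; rewrite !scale0r.
Qed.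

Import VectorInternalTheory.

Section BimoduleExtension.
Variables (K : fieldType) (A : vectType K) (prec succ dot : A -> A -> A).
Hypothesis postAsA : is_postAs prec succ dot.
Local Notation total := (postAs_total prec succ dot).
Local Notation ext := 'rV[K]_(1 + (dim A + dim A)).

Lemma postAs_total_bilinear : bilinear_op total.
Proof.
have [pDl pDr pZl pZr] := bilinear_opE (postAs_prec_bilinear postAsA).
have [sDl sDr sZl sZr] := bilinear_opE (postAs_succ_bilinear postAsA).
have [dDl dDr dZl dZr] := bilinear_opE (postAs_dot_bilinear postAsA).
have totl a : linear (total^~ a).
  move=> k x y; rewrite /postAs_total sDl pDl dDl sZl pZl dZl !scalerDr.
  by rewrite (addrACA _ (succ y a)) [LHS]addrACA.
have totr a : linear (total a).
  move=> k x y; rewrite /postAs_total sDr pDr dDr sZr pZr dZr !scalerDr.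
  by rewrite (addrACA _ (succ a y)) [LHS]addrACA.
by split.
Qed.

Lemma postAs_totalA a b c : total (total a b) c = total a (total b c).
Proof.
have [pD _ _ _] := bilinear_opE (postAs_prec_bilinear postAsA).
have [dD dD' _ _] := bilinear_opE (postAs_dot_bilinear postAsA).
have [_ sD _ _] := bilinear_opE (postAs_succ_bilinear postAsA).
have totalE x y : total x y = succ x y + prec x y + dot x y by [].
rewrite (totalE (total a b) c) (totalE a (total b c)).
rewrite (postAs_succ_succ postAsA) {1 2}/postAs_total !pD !dD.
rewrite (postAs_prec_prec postAsA) (postAs_succ_prec postAsA).
rewrite (postAs_dot_prec postAsA) (postAs_succ_dot postAsA).
rewrite (postAs_prec_dot postAsA) (postAs_dotA postAsA).
move: (prec a (total b c)) => w; rewrite totalE !sD !dD'.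
rewrite -!addrA; congr (_ + _); congr (_ + _).
rewrite [RHS]addrCA; congr (_ + _); rewrite addrCA; congr (_ + _).
exact: addrCA.
Qed.

(** Rows are elements of the algebra k + A + A, the second summand being
    (A, * ) and the third the ideal (A, .). *)
Definition ext_row (k : K) (b c : A) : ext :=
  row_mx k%:M (row_mx (v2r b) (v2r c)).
Definition ext_scal (u : ext) : K := lsubmx u 0 0.
Definition ext_total (u : ext) : A := r2v (lsubmx (rsubmx u)).
Definition ext_ideal (u : ext) : A := r2v (rsubmx (rsubmx u)).

Lemma ext_rowE k b c :
  [/\ ext_scal (ext_row k b c) = k, ext_total (ext_row k b c) = b &
      ext_ideal (ext_row k b c) = c].
Proof.
rewrite /ext_scal /ext_total /ext_ideal !(row_mxKl, row_mxKr) !v2rK.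
by rewrite mxE eqxx.
Qed.

Lemma ext_row_linear a k b c k' b' c' :
  a *: ext_row k b c + ext_row k' b' c' =
  ext_row (a * k + k') (a *: b + b') (a *: c + c').
Proof.
rewrite /ext_row !scale_row_mx !add_row_mx -!linearP /= scale_scalar_mx.
by rewrite -raddfD.
Qed.

Lemma ext_coord_linear a u v :
  [/\ ext_scal (a *: u + v) = a * ext_scal u + ext_scal v,
      ext_total (a *: u + v) = a *: ext_total u + ext_total v &
      ext_ideal (a *: u + v) = a *: ext_ideal u + ext_ideal v].
Proof. by rewrite /ext_scal /ext_total /ext_ideal !linearP /= !mxE. Qed.

(** Right rather than left multiplications are taken because matrices act on
    rows from the right, so that no product is reversed. *)
Definition rmul_total (a : A) (u : ext) : ext :=
  ext_row 0 (ext_scal u *: a + total (ext_total u) a) (prec (ext_ideal u) a).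
Definition rmul_ideal (a : A) (u : ext) : ext :=
  ext_row 0 0
    (ext_scal u *: a + succ (ext_total u) a + dot (ext_ideal u) a).

Lemma rmul_total_linear a : linear (rmul_total a).
Proof.
have [tD _ tZ _] := bilinear_opE postAs_total_bilinear.
have [pD _ pZ _] := bilinear_opE (postAs_prec_bilinear postAsA).
move=> k u v; rewrite /rmul_total; case: (ext_coord_linear k u v) => -> -> ->.
rewrite ext_row_linear mulr0 addr0 tD tZ pD pZ.
by rewrite (scalerDr k (_ *: a)) scalerDl scalerA addrACA.
Qed.

Lemma rmul_ideal_linear a : linear (rmul_ideal a).
Proof.
have [sD _ sZ _] := bilinear_opE (postAs_succ_bilinear postAsA).
have [dD _ dZ _] := bilinear_opE (postAs_dot_bilinear postAsA).
move=> k u v; rewrite /rmul_ideal; case: (ext_coord_linear k u v) => -> -> ->.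
rewrite ext_row_linear mulr0 scaler0 !addr0 sD sZ dD dZ scalerDl !scalerDr.
by rewrite scalerA (addrACA _ (_ *: a)); congr ext_row; exact: addrACA.
Qed.

Lemma mul_lin1_mx m (f : 'rV[K]_m -> 'rV[K]_m) u :
  linear f -> u *m lin1_mx f = f u.
Proof.
move=> lin_f.
pose g : {linear _ -> _} := HB.pack f (GRing.isLinear.Build _ _ _ _ f lin_f).
exact: (mul_rV_lin1 g).
Qed.

Lemma eq_mulmx_row m (M N : 'M[K]_m) :
  (forall u : 'rV_m, u *m M = u *m N) -> M = N.
Proof. by move=> MN; apply/row_matrixP => i; rewrite !rowE MN. Qed.

(** The unit adjoined to A + A makes the regular representation faithful, which
    gives the injectivity of rho and iota. *)
Lemma bimodule_extension : exists (N : nat) (rho iota : A -> 'M[K]_N.+1),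
  [/\ linear rho, linear iota, injective iota, injective rho &
    [/\ forall a b, rho a * rho b = rho (total a b),
        forall a b, rho a * iota b = iota (succ a b),
        forall a b, iota a * rho b = iota (prec a b) &
        forall a b, iota a * iota b = iota (dot a b)]].
Proof.
have [pDl pDr pZl pZr] := bilinear_opE (postAs_prec_bilinear postAsA).
have [sDl sDr sZl sZr] := bilinear_opE (postAs_succ_bilinear postAsA).
have [dDl dDr dZl dZr] := bilinear_opE (postAs_dot_bilinear postAsA).
have [tDl tDr tZl tZr] := bilinear_opE postAs_total_bilinear.
have s0 := bilinear_op0l _ (postAs_succ_bilinear postAsA).
have d0 := bilinear_op0l _ (postAs_dot_bilinear postAsA).
have t0 := bilinear_op0l _ postAs_total_bilinear.
pose rho a : 'M[K]_((dim A + dim A).+1) := lin1_mx (rmul_total a).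
pose iota a : 'M[K]_((dim A + dim A).+1) := lin1_mx (rmul_ideal a).
have rhoE a u : u *m rho a = rmul_total a u.
  exact/mul_lin1_mx/rmul_total_linear.
have iotaE a u : u *m iota a = rmul_ideal a u.
  exact/mul_lin1_mx/rmul_ideal_linear.
have scalE k b c : ext_scal (ext_row k b c) = k by case: (ext_rowE k b c).
have totalE k b c : ext_total (ext_row k b c) = b by case: (ext_rowE k b c).
have idealE k b c : ext_ideal (ext_row k b c) = c by case: (ext_rowE k b c).
exists (dim A + dim A)%N, rho, iota; split.
- move=> k a b; apply: eq_mulmx_row => u; rewrite mulmxDr -scalemxAr !rhoE.
  rewrite /rmul_total ext_row_linear mulr0 addr0 tDr tZr pDr pZr.
  rewrite (scalerDr k (_ *: a)) scalerDr !scalerA [k * _]mulrC.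
  by congr ext_row; exact: addrACA.
- move=> k a b; apply: eq_mulmx_row => u; rewrite mulmxDr -scalemxAr !iotaE.
  rewrite /rmul_ideal ext_row_linear mulr0 scaler0 !addr0 sDr sZr dDr dZr.
  rewrite !scalerDr !scalerA [k * _]mulrC.
  by rewrite (addrACA _ (_ *: b)); congr ext_row; exact: addrACA.
- move=> a b /(congr1 (fun M => ext_ideal (ext_row 1 0 0 *m M))).
  rewrite !iotaE /rmul_ideal.
  by rewrite !(scalE, totalE, idealE) !s0 !d0 !scale1r !addr0.
- move=> a b /(congr1 (fun M => ext_total (ext_row 1 0 0 *m M))).
  rewrite !rhoE /rmul_total.
  by rewrite !(scalE, totalE) !t0 !scale1r !addr0.
split=> a b; apply: eq_mulmx_row => u; rewrite -mulmxE mulmxA !(rhoE, iotaE).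
- rewrite /rmul_total.
  rewrite !(scalE, totalE, idealE) scale0r add0r.
  by rewrite tDl tZl postAs_totalA (postAs_prec_prec postAsA).
- rewrite /rmul_ideal /rmul_total.
  rewrite !(scalE, totalE, idealE) scale0r add0r sDl sZl (postAs_succ_succ postAsA).
  by rewrite (postAs_prec_dot postAsA).
- rewrite /rmul_ideal /rmul_total.
  rewrite !(scalE, totalE, idealE) scale0r add0r t0 !pDl pZl (postAs_succ_prec postAsA).
  by rewrite (postAs_dot_prec postAsA).
- rewrite /rmul_ideal.
  rewrite !(scalE, totalE, idealE) scale0r add0r s0 add0r !dDl dZl (postAs_succ_dot postAsA).
  by rewrite (postAs_dotA postAsA).
Qed.

End BimoduleExtension.

(** * The obstruction *)

Lemma horner_alg_char_poly (K : fieldType) (N : nat) (M : 'M[K]_N.+1) :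
  horner_alg M (char_poly M) = 0.
Proof.
have mxE : horner_mx M (char_poly M) = horner_alg (horner_mx M 'X) (char_poly M).
  exact: poly_alg_initial.
by rewrite -{1}[M]horner_mx_X -mxE Cayley_Hamilton.
Qed.

Lemma no_half_weight_pair (K : fieldType) (charK0 : [pchar K] =i pred0)
    (A : vectType K) (prec succ dot : A -> A -> A) (X E : A) :
  is_postAs prec succ dot ->
  induced_product prec succ X X = X ->
  induced_bracket dot X E = 0 ->
  induced_product prec succ X E - induced_product prec succ E X = 2%:R^-1 *: E ->
  E = 0.
Proof.
move=> postAsA XX XE_br XE_tr.
have [N [rho [iota [rho_lin iota_lin iota_inj rho_inj [rr ri ir ii]]]]] :=
  bimodule_extension postAsA.
pose rhoL : {linear _ -> _} :=
  HB.pack rho (GRing.isLinear.Build _ _ _ _ rho rho_lin).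
pose iotaL : {linear _ -> _} :=
  HB.pack iota (GRing.isLinear.Build _ _ _ _ iota iota_lin).
have rho0 : rho 0 = 0 by apply: (raddf0 rhoL).
have iota0 : iota 0 = 0 by apply: (raddf0 iotaL).
have iotaD a b : iota (a + b) = iota a + iota b by apply: (raddfD iotaL).
have rhoD a b : rho (a + b) = rho a + rho b by apply: (raddfD rhoL).
have iotaZ k a : iota (k *: a) = k *: iota a by apply: (linearZZ iotaL).
have rhoZ k a : rho (k *: a) = k *: rho a by apply: (linearZZ rhoL).
have rhoB a b : rho (a - b) = rho a - rho b by apply: (raddfB rhoL).
have iotaB a b : iota (a - b) = iota a - iota b by apply: (raddfB iotaL).
(* sigma = rho + iota is multiplicative for the total product. *)
have sigmaM a b : (rho a + iota a) * (rho b + iota b) =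
    rho (postAs_total prec succ dot a b) + iota (postAs_total prec succ dot a b).
  rewrite mulrDl !mulrDr rr ri ir ii -addrA; congr (_ + _).
  by rewrite /postAs_total !iotaD addrA.
apply: rho_inj; rewrite rho0.
apply: (half_weight_eq0 charK0 (h := rho X) (n := iota X) (chi := char_poly (rho X))).
- exact/monic_neq0/char_poly_monic.
- exact: horner_alg_char_poly.
- by rewrite ri ir -iotaB -[in RHS]XX.
- rewrite !rr -rhoB -rhoZ -XE_tr; congr rho.
  rewrite /postAs_total /induced_product (subr0_eq XE_br) opprD addrACA subrr.
  rewrite addr0 opprB [RHS]addrACA -opprD; congr (_ - _); exact: addrC.
(* a is the value of p * 'X at X for the total product. *)
move=> p eq_p.
have [a [aE bE]] : exists a, rho a = horner_alg (rho X) (p * 'X) /\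
    rho a + iota a = horner_alg (rho X + iota X) (p * 'X).
  elim/poly_ind: (p) => [|q c [a [aE bE]]].
    by exists 0; rewrite mul0r !rmorph0 rho0 iota0 addr0.
  have hornerS h : horner_alg h ((q * 'X + c%:P) * 'X) =
      horner_alg h (q * 'X) * h + c *: h :> 'M[K]_N.+1.
    rewrite rmorphM rmorphD /= horner_algX horner_algC mulrDl.
    by rewrite -scalerAl mul1r.
  exists (postAs_total prec succ dot a X + c *: X); rewrite !hornerS -aE -bE.
  by rewrite sigmaM rhoD iotaD rhoZ iotaZ addrACA scalerDr rr.
suff a0 : a = 0 by rewrite -aE a0 rho0.
apply: iota_inj; rewrite iota0; apply: (addrI (rho a)).
by rewrite addr0 bE aE eq_p.
Qed.

Unset Implicit Arguments.

Theorem theorem4p2 (K : fieldType) (charK0 : [pchar K] =i pred0)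
    (L : vectType K) (x e : L) (basis_xe : basis_of {:L}%VS [:: x; e])
    (tr : L -> L -> L) (tr_bilinear : bilinear_op tr)
    (tr_xx : tr x x = x) (tr_xe : tr x e = 2%:R^-1 *: e)
    (tr_ex : tr e x = 0) (tr_ee : tr e e = 0) :
  is_postLie (fun _ _ : L => 0) tr /\
  ~ has_A_postAs (fun _ _ : L => 0) tr.
Proof.
have [tDl tDr tZl tZr] := bilinear_opE tr_bilinear.
split; last first.
  case=> A [prec [succ [dot [postAsA [f [f_inj [f_br f_tr]]]]]]].
  have e0 : e != 0.
    by apply: (free_not0 (basis_free basis_xe)); rewrite !inE eqxx orbT.
  apply: (elimN eqP e0).
  apply: f_inj; rewrite linear0.
  apply: (no_half_weight_pair charK0 (X := f x) postAsA).
  - by rewrite -f_tr tr_xx.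
  - by rewrite -f_br linear0.
  - by rewrite -!f_tr tr_xe tr_ex linear0 subr0 linearZ.
have tr0r a : tr a 0 = 0 by have := tZr 0 0 a; rewrite !scale0r.
have zero_lin : linear (fun _ : L => 0 : L).
  by move=> k u v; rewrite scaler0 addr0.
have coordP (y : L) : exists a b, y = a *: x + b *: e.
  have : y \in <<[:: x; e]>>%VS by rewrite (span_basis basis_xe) memvf.
  rewrite span_cons span_seq1 => /memv_addP [_ /vlineP [a ->] [_ /vlineP [b ->] ->]].
  by exists a, b.
have tr_e z : tr e z = 0.
  by have [a [b ->]] := coordP z; rewrite tDr !tZr tr_ex tr_ee !scaler0 addr0.
split=> //.
- by split=> // *; rewrite ?addr0.
- by move=> y z w; rewrite tr0r addr0.
move=> y z w.
have [a [b yE]] := coordP y; have [c [d zE]] := coordP z.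
have tr_y u : tr y u = a *: tr x u by rewrite yE tDl !tZl tr_e scaler0 addr0.
have tr_z u : tr z u = c *: tr x u by rewrite zE tDl !tZl tr_e scaler0 addr0.
rewrite /postLie_commutator !tr_y !tr_z !tZr !scalerA [c * a]mulrC subrr add0r.
have tr_x u v : tr x (u *: x + v *: e) = u *: x + (v / 2%:R) *: e.
  by rewrite tDr !tZr tr_xx tr_xe scalerA.
rewrite yE zE !tr_x !scalerDr !scalerA [c * a]mulrC opprD addrACA subrr add0r.
by rewrite -scalerBl tZl tr_e scaler0.
Qed.
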